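(* The function $$f(s,t)=\sum_{k=0}^\infty\sum_{m=0}^k\binom{k}{m}_Ks^{q^m}t^{q^k}\in\mathcal F_2$$ satisfies the equation $$d_sf(s,t)=\Delta_tf(s,t)+[1]^{1/q}f(s,t),$$ so that $f$ is quasi-holonomic, i.e. $d(M_f)=2$.
   Context: Let $q$ be a power of a prime $p$, $K=\mathbb F_q((x))$ the field of formal Laurent series with its absolute value $|x|=q^{-1}$, and $\overline{K}_c$ the completion of an algebraic closure of $K$ with the extended absolute value. Put $[i]=x^{q^i}-x$ ($i\ge1$), $D_i=[i][i-1]^q\cdots[1]^{q^{i-1}}$ ($i\ge1$), $D_0=1$. The $K$-binomial coefficients are $$\binom{k}{m}_K=\frac{D_k}{D_mD_{k-m}^{q^m}},\qquad 0\le m\le k.$$ $\mathcal F_2$ is the set of germs at the origin of functions $f(s,t)=\sum_{k=0}^\infty\sum_{m=0}^ka_{m,k}s^{q^m}t^{q^k}$, $a_{m,k}\in\overline{K}_c$, convergent on some neighbourhood of the origin. The Carlitz ring $\mathfrak A_2$ is the ring of operators on $\mathcal F_2$ generated by the multiplications by scalars from $\overline{K}_c$ and the operators $\tau f=f^q$, $d_sf(s,t)=\bigl(f(xs,t)-xf(s,t)\bigr)^{1/q}$, $\Delta_tf(s,t)=f(s,xt)-xf(s,t)$. Every element of $\mathfrak A_2$ is a finite sum $\sum c_{l,\mu,i}\tau^ld_s^\mu\Delta_t^i$ with $c_{l,\mu,i}\in\overline{K}_c$. For $0\ne f\in\mathcal F_2$ let $I_f=\{\varphi\in\mathfrak A_2:\varphi(f)=0\}$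 and $M_f=\mathfrak A_2/I_f\cong\mathfrak A_2f$. Let $\mathfrak M_j$ be the $\overline{K}_c$-span of the elements $\tau^ld_s^\mu\Delta_t^if$ with $l+\mu+i\le j$. There is a polynomial $\chi\in\mathbb Q[t]$ with $\dim_{\overline{K}_c}\mathfrak M_j=\chi(j)$ for all large $j$, and $d(M_f)=\deg\chi$. The function $f\in\mathcal F_2$ is called quasi-holonomic if $d(M_f)=2$. *)

(* Defs.v *)
From HB Require Import structures.
From mathcomp Require Import all_boot all_order all_algebra.
From mathcomp Require Import zify.
From mathcomp Require Import all_classical all_reals topology normedtype sequences.

Set Implicit Arguments.
Unset Strict Implicit.
Unset Printing Implicit Defensive.

Import Order.TTheory GRing.Theory Num.Theory.
Import numFieldNormedType.Exports.

Local Open Scope classical_set_scope.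
Local Open Scope ring_scope.

(* The field $F((x))$ of formal Laurent series: an element is its family of
   coefficients, indexed by integers and vanishing far enough to the left. *)
Section Laurent.
Variable F : fieldType.

Definition laurent_pred : {pred int -> F} :=
  fun f => `[< exists N : int, forall n, n < N -> f n = 0 >].

Record laurent := Laurent { lcoef :> int -> F; _ : lcoef \in laurent_pred }.

HB.instance Definition _ := [isSub for lcoef].
HB.instance Definition _ := [Choice of laurent by <:].

Fact laurent_zmod_closed : zmod_closed laurent_pred.
Proof.
split; first by apply/asboolP; exists 0 => n _.
move=> f g /asboolP[N fN] /asboolP[M gM]; apply/asboolP.
exists (Num.min N M) => n; rewrite lt_min => /andP[nN nM].
by rewrite [LHS](_ : _ = f n - g n) // fN // gM // subr0.
Qed.

HB.instance Definition _ :=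
  GRing.isZmodClosed.Build (int -> F) laurent_pred laurent_zmod_closed.
HB.instance Definition _ := [SubChoice_isSubZmodule of laurent by <:].

Lemma laurentP (f g : laurent) : (forall n, f n = g n) -> f = g.
Proof. by move=> fg; apply/val_inj/funext. Qed.

Lemma laurent_bound (f : laurent) : exists N : int, forall n, n < N -> f n = 0.
Proof. by case: f => f /= /asboolP. Qed.

Lemma lcoefD (f g : laurent) n : (f + g) n = f n + g n.
Proof. by []. Qed.

Lemma lcoef0 n : (0 : laurent) n = 0.
Proof. by []. Qed.

(* Cauchy product; the sum has finite support. *)
Definition lmul_fun (f g : int -> F) : int -> F :=
  fun n => \sum_(i \in [set: int]) f i * g (n - i).

Definition trunc (f : int -> F) (N : int) (M : nat) : {poly F} :=
  \poly_(i < M) f (N + i%:Z).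

Lemma lmul_window (f g : int -> F) (N N' : int) (M k : nat) :
    (forall n, n < N -> f n = 0) -> (forall n, n < N' -> g n = 0) ->
    (k < M)%N ->
  lmul_fun f g (N + N' + k%:Z) = (trunc f N M * trunc g N' M)`_k.
Proof.
move=> fN gN kM; rewrite coefM /lmul_fun.
rewrite (fsbigE [seq N + i%:Z | i <- iota 0 k.+1]) //.
- rewrite big_map -[iota 0 k.+1]/(index_iota 0 k.+1) big_mkord.
  apply: eq_big => [i|i _]; first by rewrite in_setT.
  have ik : (i <= k)%N by rewrite -ltnS.
  rewrite !coef_poly (leq_ltn_trans ik kM) (leq_ltn_trans (leq_subr _ _) kM).
  congr (_ * g _); rewrite -subzn //; lia.
- by rewrite map_inj_uniq ?iota_uniq // => i j; lia.
- move=> i _ iN; have [/fN->|Ni] := ltP i N; first by rewrite mul0r.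
  rewrite gN ?mulr0 // ltNge; apply: contra iN => N'i.
  apply/mapP; exists `|i - N|%N; last by lia.
  by rewrite mem_iota; lia.
Qed.

Lemma lmul_low (f g : int -> F) (N N' n : int) :
    (forall n, n < N -> f n = 0) -> (forall n, n < N' -> g n = 0) ->
  n < N + N' -> lmul_fun f g n = 0.
Proof.
move=> fN gN nN; apply: fsbig1 => i _.
have [/fN->|Ni] := ltP i N; first by rewrite mul0r.
by rewrite gN ?mulr0 //; lia.
Qed.

Lemma lmul_in (f g : laurent) : lmul_fun f g \in laurent_pred.
Proof.
have [N fN] := laurent_bound f; have [N' gN] := laurent_bound g.
by apply/asboolP; exists (N + N') => n; apply: lmul_low.
Qed.

Definition lmul (f g : laurent) : laurent := Laurent (lmul_in f g).

Lemma lmulE (f g : laurent) n : lmul f g n = lmul_fun f g n.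
Proof. by []. Qed.

Definition lmono_fun (d : int) : int -> F := fun n => (n == d)%:R.

Lemma lmono_in d : lmono_fun d \in laurent_pred.
Proof.
by apply/asboolP; exists d => n nd; rewrite /lmono_fun lt_eqF.
Qed.

(* The monomial $x^d$. *)
Definition lmono d : laurent := Laurent (lmono_in d).

Lemma lmono_low d n : n < d -> lmono d n = 0.
Proof. by move=> nd; rewrite /= /lmono_fun lt_eqF. Qed.

Lemma int_window (N n : int) : N <= n -> exists k : nat, n = N + k%:Z.
Proof. by move=> Nn; exists `|n - N|%N; lia. Qed.

Lemma coefM_trunc (p p' r : {poly F}) (M k : nat) :
  (forall i, (i < M)%N -> p`_i = p'`_i) -> (k < M)%N -> (p * r)`_k = (p' * r)`_k.
Proof.
move=> pp' kM; rewrite !coefM; apply: eq_bigr => i _; rewrite pp' //.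
by apply: leq_ltn_trans kM; rewrite -ltnS.
Qed.

Lemma lmulC : commutative lmul.
Proof.
move=> f g; apply: laurentP => n; rewrite !lmulE.
have [N fN] := laurent_bound f; have [N' gN] := laurent_bound g.
have [nN|] := ltP n (N + N').
  by rewrite (lmul_low fN gN nN) (lmul_low gN fN) // addrC.
case/int_window=> k ->; rewrite (lmul_window fN gN (ltnSn k)).
by rewrite (addrC N) (lmul_window gN fN (ltnSn k)) mulrC.
Qed.

Lemma lmulA : associative lmul.
Proof.
move=> f g h; apply: laurentP => n; rewrite !lmulE.
have [N fN] := laurent_bound f; have [N' gN] := laurent_bound g.
have [N'' hN] := laurent_bound h.
have ghN m : m < N' + N'' -> lmul g h m = 0 by apply: lmul_low.
have fgN m : m < N + N' -> lmul f g m = 0 by apply: lmul_low.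
have [nN|] := ltP n (N + N' + N'').
  by rewrite (lmul_low fgN hN nN) (lmul_low fN ghN) // addrA.
case/int_window=> k ->; rewrite (lmul_window fgN hN (ltnSn k)).
rewrite -(addrA N) (lmul_window fN ghN (ltnSn k)).
transitivity (trunc f N k.+1 * (trunc g N' k.+1 * trunc h N'' k.+1))`_k.
  rewrite ![trunc f N k.+1 * _]mulrC; apply: (@coefM_trunc _ _ _ k.+1) => // i ik.
  by rewrite coef_poly ik -(lmul_window gN hN ik).
rewrite mulrA; apply/esym/(@coefM_trunc _ _ _ k.+1) => // i ik.
by rewrite coef_poly ik -(lmul_window fN gN ik).
Qed.

Lemma lmul1 : left_id (lmono 0) lmul.
Proof.
move=> f; apply: laurentP => n; rewrite lmulE.
have [N fN] := laurent_bound f.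
have [nN|] := ltP n N.
  by rewrite (lmul_low (@lmono_low 0) fN) ?add0r // fN.
case/int_window=> k ->; rewrite -{1}[N]add0r.
rewrite (lmul_window (@lmono_low 0) fN (ltnSn k)).
rewrite (_ : trunc _ 0 _ = 1); first by rewrite mul1r coef_poly ltnSn.
apply/polyP => i; rewrite coef_poly coef1 /= /lmono_fun add0r.
by case: i => [|i] //=; rewrite if_same.
Qed.

Lemma lmulDl : left_distributive lmul +%R.
Proof.
move=> f g h; apply: laurentP => n; rewrite lcoefD !lmulE.
have [A fA] := laurent_bound f; have [B gB] := laurent_bound g.
have [N'' hN] := laurent_bound h.
pose N := Num.min A B.
have fN m : m < N -> f m = 0 by rewrite lt_min => /andP[/fA].
have gN m : m < N -> g m = 0 by rewrite lt_min => /andP[_ /gB].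
have fgN m : m < N -> (f + g) m = 0.
  by move=> mN; rewrite lcoefD fN // gN // addr0.
have [nN|] := ltP n (N + N'').
  by rewrite !(lmul_low _ hN nN) // addr0.
case/int_window=> k ->; rewrite !(lmul_window _ hN (ltnSn k)) // -coefD -mulrDl.
apply: (@coefM_trunc _ _ _ k.+1) => // i ik.
by rewrite coefD !coef_poly ik lcoefD.
Qed.

Lemma lmono_neq0 d : lmono d != 0.
Proof.
apply/eqP => /(congr1 (fun f : laurent => f d)) E.
have /eqP : lmono_fun d d = 0 := E.
by rewrite /lmono_fun eqxx oner_eq0.
Qed.

HB.instance Definition _ := GRing.Zmodule_isComNzRing.Build laurent
  lmulA lmulC lmul1 lmulDl (lmono_neq0 0).

Lemma series_inv (a : nat -> F) : a 0%N != 0 ->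
  exists b : nat -> F, forall k, \sum_(i < k.+1) a i * b (k - i)%N = (k == 0%N)%:R.
Proof.
move=> a0.
pose nxt (s : seq F) m :=
  (a 0%N)^-1 * ((m == 0%N)%:R - \sum_(i < m) a i.+1 * s`_(m - i.+1)).
pose fix bs n := if n is m.+1 then rcons (bs m) (nxt (bs m) m) else [::].
have sbs n : size (bs n) = n by elim: n => //= n IH; rewrite size_rcons IH.
have bsE n i : (i < n)%N -> (bs n)`_i = nxt (bs i) i.
  elim: n => // n IH; rewrite ltnS leq_eqVlt => /predU1P[->|ilt] /=.
    by rewrite nth_rcons sbs ltnn eqxx.
  by rewrite nth_rcons sbs ilt IH.
exists (fun n => nxt (bs n) n) => k.
rewrite big_ord_recl subn0 /= {1}/nxt mulVKf //.
rewrite [X in _ + X](eq_bigr (fun i : 'I_k => a i.+1 * (bs k)`_(k - i.+1))).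
  by rewrite subrK.
by move=> i _; rewrite bsE //; case: i => i /=; lia.
Qed.

Lemma laurent_order (f : laurent) : f != 0 ->
  exists N : int, f N != 0 /\ forall n, n < N -> f n = 0.
Proof.
move=> f0; have [B fB] := laurent_bound f.
have exm : exists m : nat, f (B + m%:Z) != 0.
  apply: contrapT => nex; move/eqP: f0; apply; apply: laurentP => n.
  have [/fB//|] := ltP n B; case/int_window=> k ->; rewrite lcoef0.
  by apply/eqP/negP => /negP fk; apply: nex; exists k.
case: (ex_minnP exm) => m fm mmin; exists (B + m%:Z); split=> // n nm.
have [/fB//|] := ltP n B; case/int_window=> k nk; subst n.
by apply/eqP/negP => /negP /mmin; lia.
Qed.

Lemma laurent_inv_ex (f : laurent) : f != 0 -> exists g : laurent, g * f = 1.
Proof.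
case/laurent_order=> N [fN0 fN].
have [|b bE] := @series_inv (fun i => f (N + i%:Z)); first by rewrite addr0.
pose gf (n : int) : F := if n < - N then 0 else b (absz (n + N)).
have gN n : n < - N -> gf n = 0 by rewrite /gf => ->.
have gin : gf \in laurent_pred by apply/asboolP; exists (- N).
exists (Laurent gin); rewrite mulrC; apply: laurentP => n.
change (lmul_fun f gf n = lmono_fun 0 n); rewrite /lmono_fun.
have [n0|] := ltP n 0.
  by rewrite (lmul_low fN gN) ?subrr // lt_eqF.
case/int_window=> k ->; rewrite -(subrr N) (lmul_window fN gN (ltnSn k)).
rewrite coefM (_ : (N - N + k%:Z == N - N) = (k == 0%N)); last by lia.
rewrite -bE; apply: eq_bigr => i _.
rewrite !coef_poly ltn_ord ltnS leq_subr; congr (_ * _).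
rewrite /gf ifF; last by lia.
by congr b; lia.
Qed.

Definition linv (f : laurent) : laurent :=
  if f == 0 then 0 else xget 0 [set g | g * f = 1].

Lemma lmulVf f : f != 0 -> linv f * f = 1.
Proof.
by move=> f0; rewrite /linv (negbTE f0); have /xgetPex := laurent_inv_ex f0; apply.
Qed.

Lemma linv0 : linv 0 = 0. Proof. by rewrite /linv eqxx. Qed.

HB.instance Definition _ := GRing.ComNzRing_isField.Build laurent lmulVf linv0.

End Laurent.

Section AbsoluteValues.
Variable R : realType.

Definition laurent_ord (F : fieldType) (f : laurent F) : int :=
  xget 0 [set N : int | f N != 0 /\ forall n, n < N -> f n = 0].

(* Normalized so that $|x| = q^{-1}$, where $q = \#F$. *)
Definition laurent_abs (F : finFieldType) (f : laurent F) : R :=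
  if f == 0 then 0 else (#|F|%:R : R) ^ (- laurent_ord f).

Definition is_abs (L : fieldType) (v : L -> R) : Prop :=
  [/\ forall y, 0 <= v y,
      forall y, v y = 0 <-> y = 0,
      forall y z, v (y * z) = v y * v z
    & forall y z, v (y + z) <= Num.max (v y) (v z)].

Definition abs_cvg (C : fieldType) (v : C -> R) (u : nat -> C) (l : C) : Prop :=
  (fun n => v (u n - l)) @ \oo --> (0 : R).

Definition abs_complete (C : fieldType) (v : C -> R) : Prop :=
  forall u : nat -> C,
    (forall e : R, 0 < e -> exists N : nat, forall m n : nat,
       (N <= m)%N -> (N <= n)%N -> v (u m - u n) < e) ->
  exists l, abs_cvg v u l.

(* [L] is algebraically closed by its type. *)
Definition is_algebraic_closure (K : fieldType) (L : closedFieldType)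
    (iota : {rmorphism K -> L}) : Prop :=
  forall y : L, algebraicOver iota y.

Definition is_completion (L C : fieldType) (vL : L -> R) (vC : C -> R)
    (iota : {rmorphism L -> C}) : Prop :=
  [/\ forall y, vC (iota y) = vL y,
      abs_complete vC
    & forall (z : C) (e : R), 0 < e -> exists y : L, vC (z - iota y) < e].

End AbsoluteValues.

Section Carlitz.
(* [C] plays the role of $\overline{K}_c$, with absolute value [v]. *)
Variables (R : realType) (C : fieldType) (v : C -> R) (q : nat) (x : C).

Definition bracket (i : nat) : C := x ^+ (q ^ i) - x.

Definition carlitzD (i : nat) : C :=
  \prod_(1 <= j < i.+1) bracket j ^+ (q ^ (i - j)).

Definition Kbinom (k m : nat) : C :=
  carlitzD k / (carlitzD m * carlitzD (k - m) ^+ (q ^ m)).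

(* The $q$-th root, unique when [q] is a power of the characteristic. *)
Definition qroot (z : C) : C := xget 0 [set y | y ^+ q = z].

(* A germ at the origin of $C^2$ is represented by a total function, up to
   equality on a neighbourhood of the origin. *)
Definition germ_eq (f g : C -> C -> C) : Prop :=
  exists2 r : R, 0 < r & forall s t, v s < r -> v t < r -> f s t = g s t.

Definition psum (a : nat -> nat -> C) (s t : C) (n : nat) : C :=
  \sum_(k < n) \sum_(m < k.+1) a m k * s ^+ (q ^ m) * t ^+ (q ^ k).

(* The value is meaningful only where the series converges. *)
Definition series_sum (a : nat -> nat -> C) (s t : C) : C :=
  xget 0 [set l | abs_cvg v (psum a s t) l].

Definition expands_as (a : nat -> nat -> C) (f : C -> C -> C) : Prop :=
  exists2 r : R, 0 < r &
    forall s t, v s < r -> v t < r -> abs_cvg v (psum a s t) (f s t).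

Definition in_F2 (f : C -> C -> C) : Prop := exists a, expands_as a f.

Definition tau (f : C -> C -> C) : C -> C -> C := fun s t => f s t ^+ q.

Definition d_s (f : C -> C -> C) : C -> C -> C :=
  fun s t => qroot (f (x * s) t - x * f s t).

Definition Delta_t (f : C -> C -> C) : C -> C -> C :=
  fun s t => f s (x * t) - x * f s t.

(* $\mathfrak M_j$, as a set of representatives of germs. *)
Definition filtration (f : C -> C -> C) (j : nat) : set (C -> C -> C) :=
  [set g | exists c : nat -> nat -> nat -> C,
    germ_eq g (fun s t =>
      \sum_(l < j.+1) \sum_(mu < j.+1) \sum_(i < j.+1 | (l + mu + i <= j)%N)
        c l mu i * iter l tau (iter mu d_s (iter i Delta_t f)) s t)].

Definition germ_dim (V : set (C -> C -> C)) (n : nat) : Prop :=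
  exists b : 'I_n -> C -> C -> C,
    [/\ forall i, V (b i),
        forall c : 'I_n -> C,
          germ_eq (fun s t => \sum_i c i * b i s t) (fun _ _ => 0) ->
          forall i, c i = 0
      & forall g, V g -> exists c : 'I_n -> C,
          germ_eq g (fun s t => \sum_i c i * b i s t)].

(* $d(M_f) = d$: the degree of the polynomial giving $\dim\mathfrak M_j$ for
   all large $j$. *)
Definition module_dim (f : C -> C -> C) (d : nat) : Prop :=
  exists chi : {poly rat}, size chi = d.+1 /\
    exists J : nat, forall j, (J <= j)%N ->
      exists n : nat, germ_dim (filtration f j) n /\ n%:R = chi.[j%:R].

Definition quasi_holonomic (f : C -> C -> C) : Prop :=
  [/\ in_F2 f, ~ germ_eq f (fun _ _ => 0) & module_dim f 2].

End Carlitz.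

(* Main.v *)
Require Import Defs.
From mathcomp Require Import all_boot all_order all_algebra.
From mathcomp Require Import pgroup abelian finfield.
From mathcomp Require Import zify ring lra.
From mathcomp Require Import all_classical all_reals topology normedtype sequences.

(** The generating function $f$ of the Carlitz binomials is studied through its
    coefficients.  The identities $[k]^q + [1] = [k+1]$ ([bracketS]) and
    $\binom{k+1}{m+1} [m+1] = \binom{k}{m}^q [k+1]$ ([KbinomSS]) carry everything.
    By the second one all binomials have absolute value $1$, so that the series
    converges on the open unit bidisk.  Together they say that the $q$-th power of
    $\binom{k}{m} ([k] + \lambda)$, where $\lambda^q = [1]$, is
    $\binom{k+1}{m+1} [m+1]$.  The former are the coefficients of
    $(\Delta_t + \lambda) f$ and the latter those of $f(xs, t) - x f(s, t)$, shifted
    by one step in each variable, as the $q$-th power requires; so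
    $d_s f = (\Delta_t + \lambda) f$.

    The same computation with a polynomial weight ([d_s_Delta_poly]) shows that
    $d_s$ sends $p(\Delta_t) f$ to $p^{1/q}(\Delta_t + \lambda) (\Delta_t + \lambda) f$,
    where $p^{1/q}$ has the $q$-th roots of the coefficients of $p$.  Hence
    $d_s^\mu \Delta_t^i f$ is a combination of the $\Delta_t^k f$ with
    $k \le \mu + i$, and $\mathfrak M_j$ is spanned by the $\tau^l \Delta_t^i f$ with
    $l + i \le j$.  These are linearly independent ([tau_Delta_free]): a relation
    holds coefficient by coefficient ([psum_coef_eq0]), and for each $l$ in turn
    the coefficients at $(l, K + l)$ form a polynomial in $[K]^{q^l}$ that vanishes
    for all $K$.  Therefore $\dim \mathfrak M_j = (j + 1)(j + 2)/2$, of degree $2$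
    in $j$. *)

Set Implicit Arguments.
Unset Strict Implicit.
Unset Printing Implicit Defensive.

Import Order.TTheory GRing.Theory Num.Theory.
Import numFieldNormedType.Exports.

Local Open Scope ring_scope.

(** * Convergence for a non-archimedean absolute value *)

Section NonArchimedean.
Variables (R : realType) (C : fieldType) (v : C -> R).
Hypothesis absv : is_abs v.

Lemma abs_ge0 y : 0 <= v y.
Proof. by case: absv. Qed.

Lemma absM y z : v (y * z) = v y * v z.
Proof. by case: absv. Qed.

Lemma absD_max y z : v (y + z) <= Num.max (v y) (v z).
Proof. by case: absv. Qed.

Lemma abs_eq0 y : (v y == 0) = (y == 0).
Proof. by case: absv => _ v0 _ _; apply/eqP/eqP => /v0. Qed.

Lemma abs0 : v 0 = 0.
Proof. by apply/eqP; rewrite abs_eq0. Qed.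

Lemma abs_gt0 y : (0 < v y) = (y != 0).
Proof. by rewrite lt0r abs_eq0 abs_ge0 andbT. Qed.

Lemma abs1 : v 1 = 1.
Proof.
have v1 : v 1 != 0 by rewrite abs_eq0 oner_eq0.
by apply: (mulfI v1); rewrite -absM !mulr1.
Qed.

Lemma absX y n : v (y ^+ n) = v y ^+ n.
Proof. by elim: n => [|n IH]; rewrite ?expr0 ?abs1 // !exprS absM IH. Qed.

Lemma absN y : v (- y) = v y.
Proof.
apply/eqP; rewrite -(@eqrXn2 _ 2) ?abs_ge0 //.
by rewrite -!absX sqrrN.
Qed.

Lemma absB_le y z e : v y <= e -> v z <= e -> v (y - z) <= e.
Proof.
by move=> ye ze; rewrite (le_trans (absD_max _ _)) // absN ge_max ye.
Qed.

Lemma absD_lt y z e : v y < e -> v z < e -> v (y + z) < e.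
Proof. by move=> ye ze; rewrite (le_lt_trans (absD_max _ _)) // gt_max ye. Qed.

Lemma abs_sum_le (I : Type) (r : seq I) (P : pred I) (F : I -> C) e :
  0 <= e -> (forall i, P i -> v (F i) <= e) -> v (\sum_(i <- r | P i) F i) <= e.
Proof.
move=> e0 Fe; elim/big_ind: _ => //; first by rewrite abs0.
by move=> y z ye ze; rewrite (le_trans (absD_max _ _)) // ge_max ye.
Qed.

(** The dominant term decides: otherwise $y = (y + z) - z$ would be a sum of two
    elements smaller than $y$. *)
Lemma absD_eq y z : v z < v y -> v (y + z) = v y.
Proof.
move=> zy; apply/eqP; rewrite eq_le; apply/andP; split.
  by rewrite (le_trans (absD_max _ _)) // ge_max lexx ltW.
have := absD_max (y + z) (- z); rewrite addrK absN le_max.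
by rewrite [v y <= v z]leNgt zy orbF.
Qed.

(** Turns filter convergence of absolute values into the epsilon form, from which
    all the limit rules below are read off. *)
Lemma abs_cvgP u l : abs_cvg v u l <->
  forall e : R, 0 < e -> exists N, forall n, (N <= n)%N -> v (u n - l) < e.
Proof.
split=> [/cvgrPdist_lt ul e /ul [N _ Ne]|ul].
  by exists N => n /Ne; rewrite sub0r normrN ger0_norm ?abs_ge0.
apply/cvgrPdist_lt => e /ul [N Ne]; exists N => // n /= /Ne.
by rewrite sub0r normrN ger0_norm ?abs_ge0.
Qed.

Lemma abs_cvg_unique u l l' : abs_cvg v u l -> abs_cvg v u l' -> l = l'.
Proof.
move=> /abs_cvgP ul /abs_cvgP ul'; apply/eqP; rewrite -subr_eq0 -abs_eq0.
rewrite eq_le abs_ge0 andbT; apply/ler_addgt0Pr => e e0; rewrite add0r.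
have [N Ne] := ul e e0; have [M Me] := ul' e e0; pose n := maxn N M.
rewrite (_ : l - l' = (u n - l') - (u n - l)); last by ring.
by apply: absB_le; apply: ltW; [apply: Me; apply: leq_maxr | apply: Ne; apply: leq_maxl].
Qed.

Lemma abs_cvgD u w l m : abs_cvg v u l -> abs_cvg v w m ->
  abs_cvg v (fun n => u n + w n) (l + m).
Proof.
move=> /abs_cvgP ul /abs_cvgP wm; apply/abs_cvgP => e e0.
have [N Ne] := ul e e0; have [M Me] := wm e e0; exists (maxn N M) => n.
by rewrite geq_max => /andP[/Ne ? /Me ?]; rewrite opprD addrACA absD_lt.
Qed.

Lemma abs_cvgZ c u l : abs_cvg v u l -> abs_cvg v (fun n => c * u n) (c * l).
Proof.
move=> /abs_cvgP ul; apply/abs_cvgP => e e0.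
have [->|c0] := eqVneq c 0; first by exists 0%N => n _; rewrite !mul0r subrr abs0.
have vc0 : 0 < v c by rewrite abs_gt0.
have [N Ne] := ul _ (divr_gt0 e0 vc0); exists N => n /Ne.
by rewrite -mulrBr absM ltr_pdivlMr // mulrC.
Qed.

Lemma abs_cvg0 : abs_cvg v (fun=> 0) 0.
Proof. by apply/abs_cvgP => e e0; exists 0%N => n _; rewrite subrr abs0. Qed.

Lemma abs_cvg_sum (I : Type) (r : seq I) (P : pred I) (u : I -> nat -> C) l :
  (forall i, P i -> abs_cvg v (u i) (l i)) ->
  abs_cvg v (fun n => \sum_(i <- r | P i) u i n) (\sum_(i <- r | P i) l i).
Proof.
move=> ul; elim: r => [|i r IH].
  under eq_fun do rewrite big_nil.
  by rewrite big_nil; apply: abs_cvg0.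
under eq_fun do rewrite big_cons.
by rewrite big_cons; case: ifP => // Pi; apply: abs_cvgD => //; apply: ul.
Qed.

Lemma abs_cvg_unshift u l : abs_cvg v (fun n => u n.+1) l -> abs_cvg v u l.
Proof.
move=> /abs_cvgP ul; apply/abs_cvgP => e /ul[N Ne]; exists N.+1 => -[//|n] Nn.
exact/Ne.
Qed.

(** Because $u^q - l^q = (u - l)^q$, and taking $q$-th powers does not increase an
    absolute value that is at most $1$. *)
Lemma abs_cvg_frob q u l : (0 < q)%N ->
    (forall a b : C, (a + b) ^+ q = a ^+ q + b ^+ q) ->
  abs_cvg v u l -> abs_cvg v (fun n => u n ^+ q) (l ^+ q).
Proof.
move=> q0 frobD /abs_cvgP ul; apply/abs_cvgP => e e0.
(* Below 1 the q-th power of a distance is at most the distance. *)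
have m0 : 0 < Num.min e 1 by rewrite lt_min e0 ltr01.
have [N Ne] := ul _ m0; exists N => n /Ne; rewrite lt_min => /andP[ue u1].
have -> : u n ^+ q - l ^+ q = (u n - l) ^+ q.
  by apply/eqP; rewrite subr_eq -frobD subrK.
rewrite absX (le_lt_trans _ ue) // -(prednK q0) exprSr ler_piMl ?abs_ge0 //.
by rewrite exprn_ile1 ?abs_ge0 // ltW.
Qed.

Lemma abs_cvg_bounded u l : abs_cvg v u l -> exists B, forall n, v (u n) <= B.
Proof.
move=> /abs_cvgP/(_ 1 ltr01)[N Ne].
(* The sum over the first terms serves as a crude maximum. *)
exists (v l + 1 + \sum_(i < N) v (u i)) => n; have [nN|/Ne n1] := ltnP n N.
  rewrite (bigD1 (Ordinal nN)) //= addrCA lerDl !addr_ge0 ?abs_ge0 //.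
  by apply: sumr_ge0 => *; apply: abs_ge0.
rewrite -[u n](subrK l) (le_trans (absD_max _ _)) // ge_max.
have S0 : 0 <= \sum_(i < N) v (u i) by apply: sumr_ge0 => *; apply: abs_ge0.
have l0 := abs_ge0 l.
apply/andP; split; first by rewrite (le_trans (ltW n1)) //; lra.
by lra.
Qed.

(** In the ultrametric setting steps that tend to zero already give a Cauchy
    sequence; the geometric bound makes the modulus explicit. *)
Lemma abs_complete_series u (rho : R) : abs_complete v -> 0 <= rho < 1 ->
  (forall n, v (u n.+1 - u n) <= rho ^+ n) -> exists l, abs_cvg v u l.
Proof.
move=> cC /andP[rho0 rho1] urho; apply: cC => e e0.
have tail N k : v (u (N + k)%N - u N) <= rho ^+ N.
  elim: k => [|k IH]; first by rewrite addn0 subrr abs0 exprn_ge0.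
  rewrite -(subrKA (u (N + k)%N)) (le_trans (absD_max _ _)) // ge_max IH andbT.
  rewrite addnS (le_trans (urho _)) // exprD ler_piMr ?exprn_ge0 //.
  by rewrite exprn_ile1 // ltW.
have /cvgrPdist_lt/(_ e e0)[N _ Ne] : ((fun n => rho ^+ n) @ \oo --> (0 : R))%classic.
  by apply: cvg_expr; rewrite ger0_norm.
have rN : rho ^+ N < e.
  by have := Ne N (leqnn N); rewrite sub0r normrN ger0_norm ?exprn_ge0.
exists N => m n /subnKC <- /subnKC <-; apply: le_lt_trans rN.
by rewrite -(subrKA (u N)) -[u N - _]opprB absB_le.
Qed.

End NonArchimedean.

(** * The Frobenius map and its inverse *)

Section Frobenius.
Variables (C : fieldType) (q : nat).
Hypothesis frobD : forall a b : C, (a + b) ^+ q = a ^+ q + b ^+ q.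
Hypothesis q_gt0 : (0 < q)%N.

Lemma frobB a b : (a - b) ^+ q = a ^+ q - b ^+ q :> C.
Proof. by apply/(addIr (b ^+ q)); rewrite -frobD !subrK. Qed.

Lemma frob_inj : injective (fun a : C => a ^+ q).
Proof.
move=> a b /eqP; rewrite -subr_eq0 -frobB expf_eq0 q_gt0 subr_eq0.
exact: eqP.
Qed.

Lemma frob_sum (I : Type) (r : seq I) (P : pred I) (F : I -> C) :
  (\sum_(i <- r | P i) F i) ^+ q = \sum_(i <- r | P i) F i ^+ q.
Proof.
by apply: (big_morph (fun a => a ^+ q) frobD); rewrite expr0n gtn_eqF.
Qed.

Lemma frobXD l (a b : C) : (a + b) ^+ (q ^ l) = a ^+ (q ^ l) + b ^+ (q ^ l).
Proof.
elim: l => [|l IH]; first by rewrite expn0 !expr1.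
by rewrite expnSr !exprM IH frobD.
Qed.

Lemma frobX_inj l : injective (fun a : C => a ^+ (q ^ l)).
Proof.
elim: l => [|l IH] a b; first by rewrite expn0 !expr1.
by rewrite expnSr !exprM => /frob_inj/IH.
Qed.

(** The only handle on [qroot] that is needed: whenever a $q$-th root is exhibited,
    injectivity of the Frobenius map makes it the chosen one. *)
Lemma qroot_expr y : qroot q (y ^+ q) = y :> C.
Proof.
apply: frob_inj; rewrite /qroot.
by apply: (@xgetPex _ 0 [set z : C | z ^+ q = y ^+ q]%classic); exists y.
Qed.

End Frobenius.

(** * Uniqueness of the coefficients of a power series *)

Lemma poly_infinite_roots (C : idomainType) (p : {poly C}) (u : nat -> C) :
  injective u -> (forall n, p.[u n] = 0) -> p = 0.
Proof.
move=> uI pu; apply: (@roots_geq_poly_eq0 _ _ [seq u n | n <- iota 0 (size p)]).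
- by apply/allP => _ /mapP[n _ ->]; apply/rootP.
- by rewrite map_inj_uniq ?iota_uniq.
- by rewrite size_map size_iota.
Qed.

Section CoefficientUniqueness.
Variables (R : realType) (C : fieldType) (v : C -> R) (q : nat) (x : C).
Hypothesis absv : is_abs v.
Hypothesis q_gt1 : (1 < q)%N.
Hypothesis x01 : 0 < v x < 1.

Lemma abs_expr_small (e : R) : 0 < e -> exists N, forall n, (N <= n)%N -> v x ^+ n < e.
Proof.
move=> e0; have /andP[x0 x1] := x01.
have /cvgrPdist_lt/(_ e e0)[N _ Ne] : ((fun n => v x ^+ n) @ \oo --> (0 : R))%classic.
  by apply: cvg_expr; rewrite ger0_norm // ltW.
exists N => n Nn; have := Ne n Nn.
by rewrite sub0r normrN ger0_norm ?exprn_ge0 ?ltW.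
Qed.

Lemma expr_x_inj : injective (fun n => x ^+ n).
Proof.
have /andP[x0 x1] := x01; move=> m n /(congr1 v); rewrite !(absX absv) => vmn.
by apply/eqP; rewrite eqn_leq -!(ler_iXn2l x0 x1) vmn lexx.
Qed.

(** Let $a_{k_0}$ be the first nonzero coefficient, and let $B$ bound the terms at
    a point $t_0$.  At $x^M t_0$ the leading term has absolute value
    $|a_{k_0} t_0^{q^{k_0}}| |x|^{M q^{k_0}}$ while all later ones are at most
    $B |x|^{M q^{k_0+1}}$.  As the sum is zero the leading term obeys the same bound,
    so $|a_{k_0} t_0^{q^{k_0}}| \le B |x|^M$ for every $M$. *)
Lemma qseries_coef_eq0 (a : nat -> C) (r : R) : 0 < r ->
    (forall t, v t < r ->
      abs_cvg v (fun n => \sum_(k < n) a k * t ^+ (q ^ k)) 0) ->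
  forall k, a k = 0.
Proof.
move=> r0 a0; have /andP[x0 x1] := x01.
have xn0 : x != 0 by rewrite -(abs_gt0 absv).
have [t0 vt0 t00] : exists2 t0, v t0 < r & t0 != 0.
  have [N /(_ N (leqnn N)) xN] := abs_expr_small r0.
  by exists (x ^+ N); rewrite ?expf_neq0 // (absX absv).
have [B uB] := abs_cvg_bounded absv (a0 _ vt0).
have aB k : v (a k * t0 ^+ (q ^ k)) <= B.
  have := absB_le absv (uB k.+1) (uB k).
  by rewrite big_ord_recr /= [_ - _]addrC addKr.
have B0 : 0 <= B by apply: le_trans (aB 0%N); apply: abs_ge0.
elim/ltn_ind => k0 IH.
have main M : v (a k0 * t0 ^+ (q ^ k0)) <= B * v x ^+ M.
  pose t := x ^+ M * t0.
  have vt : v t < r.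
    rewrite (absM absv) (le_lt_trans _ vt0) // ler_piMl ?(abs_ge0 absv) //.
    by rewrite (absX absv) exprn_ile1 ?ltW.
  have vat k : v (a k * t ^+ (q ^ k)) =
      v (a k * t0 ^+ (q ^ k)) * v x ^+ (M * q ^ k).
    by rewrite exprMn -exprM mulrCA mulrC !(absM absv) !(absX absv).
  have lead : v (a k0 * t ^+ (q ^ k0)) <= B * v x ^+ (M * q ^ k0.+1).
    apply/ler_addgt0Pr => e e0.
    have /(abs_cvgP absv)/(_ e e0)[n0 ne] := a0 t vt.
    have lt_k0 : (k0 < maxn n0 k0.+1)%N by rewrite leq_maxr.
    have := ne _ (leq_maxl n0 k0.+1); rewrite subr0 (bigD1 (Ordinal lt_k0)) //=.
    set z := \sum_(_ < _ | _) _ => sum_e.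
    have vz : v z <= B * v x ^+ (M * q ^ k0.+1).
      apply: abs_sum_le => // [|k /negP k_k0].
        by rewrite mulr_ge0 ?exprn_ge0 // ltW.
      have [/IH->|k0k] := ltnP k k0.
        by rewrite mul0r abs0 // mulr_ge0 ?exprn_ge0 // ltW.
      have {}k0k : (k0 < k)%N.
        by rewrite ltn_neqAle k0k andbT; apply/eqP => E; apply: k_k0; apply/eqP/val_inj.
      rewrite vat; apply: ler_pM; rewrite ?(abs_ge0 absv) ?aB ?exprn_ge0 ?(ltW x0) //.
      by rewrite (ler_iXn2l x0 x1) leq_mul2l leq_exp2l // k0k orbT.
    rewrite -[_ * _](addrK z) (le_trans (absD_max absv _ _)) // (absN absv) ge_max.
    have BM : 0 <= B * v x ^+ (M * q ^ k0.+1) by rewrite mulr_ge0 ?exprn_ge0 // ltW.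
    by apply/andP; split; lra.
  (* This uses that consecutive exponents $q^k$ differ by at least 1. *)
  have le_M : (M * q ^ k0 + M <= M * q ^ k0.+1)%N.
    rewrite -mulnSr leq_mul2l expnS; apply/orP; right.
    rewrite (leq_trans _ (leq_mul q_gt1 (leqnn _))) // mul2n -addnn -addn1.
    by rewrite leq_add2l expn_gt0 ltnW.
  rewrite -(ler_pM2r (exprn_gt0 (M * q ^ k0) x0)) -vat (le_trans lead) //.
  rewrite -mulrA -exprD ler_wpM2l //.
  by rewrite (ler_iXn2l x0 x1) addnC.
have vz0 : v (a k0 * t0 ^+ (q ^ k0)) <= 0.
  apply/ler_addgt0Pr => e e0; rewrite add0r.
  have B1 : 0 < B + 1 by lra.
  have [M /(_ M (leqnn M)) Me] := abs_expr_small (divr_gt0 e0 B1).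
  rewrite (le_trans (main M)) //; move: Me; rewrite ltr_pdivlMr // => Me.
  rewrite ltW // (le_lt_trans _ Me) // mulrC ler_wpM2l ?exprn_ge0 ?(ltW x0) //.
  by lra.
have : v (a k0 * t0 ^+ (q ^ k0)) == 0 by rewrite eq_le vz0 (abs_ge0 absv).
by rewrite (abs_eq0 absv) mulf_eq0 expf_eq0 (negbTE t00) andbF orbF => /eqP.
Qed.

(** All powers $x^n$ with $n$ large are roots, and they are pairwise distinct. *)
Lemma qpoly_coef_eq0 (n : nat) (a : nat -> C) (r : R) : 0 < r ->
    (forall s, v s < r -> \sum_(m < n) a m * s ^+ (q ^ m) = 0) ->
  forall m, (m < n)%N -> a m = 0.
Proof.
move=> r0 a0 m mn; have [N Ne] := abs_expr_small r0.
pose p := \sum_(m < n) a m *: 'X^(q ^ m).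
have p0 : p = 0.
  apply: (@poly_infinite_roots _ _ (fun k => x ^+ (N + k))).
    by move=> k k' /expr_x_inj/addnI.
  move=> k; rewrite horner_sum -[RHS](a0 (x ^+ (N + k))).
    by apply: eq_bigr => i _; rewrite hornerZ hornerXn.
  by rewrite (absX absv) Ne // leq_addr.
have : p`_(q ^ m) = 0 by rewrite p0 coef0.
rewrite coef_sum (bigD1 (Ordinal mn)) //= coefZ coefXn eqxx mulr1 big1 ?addr0 // => i i_m.
rewrite coefZ coefXn eqn_exp2l // [m == i](_ : _ = false) ?mulr0 //.
by apply/negbTE; apply: contra i_m => /eqP E; apply/eqP/val_inj.
Qed.

(** For fixed $s$ the series is a $q$-power series in $t$, whose coefficients are
    polynomials in $s$; the one-variable results apply in this order. *)
Lemma psum_coef_eq0 (a : nat -> nat -> C) (r : R) : 0 < r ->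
    (forall s t, v s < r -> v t < r -> abs_cvg v (psum q a s t) 0) ->
  forall m k, (m <= k)%N -> a m k = 0.
Proof.
move=> r0 a0 m k mk.
apply: (@qpoly_coef_eq0 k.+1 (a^~ k) r) => // s sr.
apply: (@qseries_coef_eq0 (fun k => \sum_(m < k.+1) a m k * s ^+ (q ^ m)) r) => // t tr.
have := a0 s t sr tr; congr abs_cvg; apply/funext => n.
by apply: eq_bigr => i _; rewrite mulr_suml.
Qed.

End CoefficientUniqueness.

(** * Carlitz binomials and the operators acting on their generating series *)

Section CarlitzOperators.
Variables (R : realType) (C : fieldType) (v : C -> R) (q : nat) (x : C).
Hypothesis absv : is_abs v.
Hypothesis frobD : forall a b : C, (a + b) ^+ q = a ^+ q + b ^+ q.
Hypothesis q_gt1 : (1 < q)%N.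
Hypothesis x01 : 0 < v x < 1.
Hypothesis completev : abs_complete v.

Local Notation br := (bracket q x).
Local Notation Delta := (Delta_t x).
Local Notation binom := (fun m k : nat => Kbinom q x k m).
Local Notation f := (series_sum v q binom).

Let q_gt0 : (0 < q)%N := ltnW q_gt1.

(** The $q$-th power of $[k] + [1]^{1/q}$ is $[k+1]$; this is what turns $\Delta_t$
    plus a constant into $d_s$. *)
Lemma bracketS k : br k ^+ q + br 1 = br k.+1.
Proof.
by rewrite /bracket (frobB frobD) -exprM -expnSr expn1 addrA subrK.
Qed.

Lemma abs_bracket k : v (br k.+1) = v x.
Proof.
have /andP[x0 x1] := x01.
rewrite /bracket addrC (absD_eq absv) (absN absv) // (absX absv).
by rewrite -{2}[v x]expr1 (ltr_iXn2l x0 x1) -(expn0 q) ltn_exp2l.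
Qed.

Lemma bracket_neq0 k : br k.+1 != 0.
Proof. by rewrite -(abs_gt0 absv) abs_bracket; case/andP: x01. Qed.

Lemma bracket_inj : injective br.
Proof.
move=> k l /addIr /(expr_x_inj absv x01) /eqP.
by rewrite eqn_exp2l // => /eqP.
Qed.

Lemma carlitzDS k : carlitzD q x k.+1 = br k.+1 * carlitzD q x k ^+ q.
Proof.
rewrite /carlitzD big_nat_recr //= subnn expn0 expr1 mulrC; congr (_ * _).
rewrite -prodrXl; apply: eq_big_nat => j /andP[_ jk].
by rewrite -exprM -expnSr subSn.
Qed.

Lemma carlitzD0 : carlitzD q x 0 = 1.
Proof. by rewrite /carlitzD big_geq. Qed.

Lemma carlitzD_neq0 k : carlitzD q x k != 0.
Proof.
elim: k => [|k IH]; first by rewrite carlitzD0 oner_eq0.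
by rewrite carlitzDS mulf_neq0 ?bracket_neq0 // expf_neq0.
Qed.

Lemma Kbinom0 k : Kbinom q x k 0 = 1.
Proof.
by rewrite /Kbinom carlitzD0 subn0 expn0 expr1 mul1r divff // carlitzD_neq0.
Qed.

(** From $D_{k+1} = [k+1] D_k^q$.  This recursion yields both the size of the
    binomials and the differential equation. *)
Lemma KbinomSS k m :
  Kbinom q x k.+1 m.+1 * br m.+1 = Kbinom q x k m ^+ q * br k.+1.
Proof.
rewrite /Kbinom subSS !carlitzDS expnSr exprM.
have [Dm Dkm] := (carlitzD_neq0 m, carlitzD_neq0 (k - m)); have bm := bracket_neq0 m.
rewrite expr_div_n exprMn.
by field; rewrite bm !expf_neq0.
Qed.

(** All $[i]$ with $i \ge 1$ have the same absolute value, so the recursion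
    preserves absolute value $1$. *)
Lemma abs_Kbinom m k : (m <= k)%N -> v (Kbinom q x k m) = 1.
Proof.
elim: m k => [|m IH] [|k] //; rewrite ?Kbinom0 ?(abs1 absv) // ltnS => mk.
have /(congr1 v) := KbinomSS k m.
rewrite !(absM absv) !abs_bracket (absX absv) IH // expr1n.
by apply: mulIf; rewrite gt_eqF //; case/andP: x01.
Qed.

(** All functions met below have an expansion valid on the same open unit bidisk, so
    working there avoids shrinking radii. *)
Definition disk_expands (a : nat -> nat -> C) (g : C -> C -> C) : Prop :=
  forall s t, v s < 1 -> v t < 1 -> abs_cvg v (psum q a s t) (g s t).

Definition disk_eq (g h : C -> C -> C) : Prop :=
  forall s t, v s < 1 -> v t < 1 -> g s t = h s t.

Lemma disk_eq_germ g h : disk_eq g h -> germ_eq v g h.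
Proof. by move=> gh; exists 1. Qed.

Lemma disk_mulx t : v t < 1 -> v (x * t) < 1.
Proof.
have /andP[x0 x1] := x01.
by move=> t1; rewrite (absM absv) mulr_ilt1 ?(abs_ge0 absv).
Qed.

(** The binomials have absolute value $1$, so the $k$-th layer is at most $|t|^k$. *)
Lemma disk_expands_series : disk_expands binom f.
Proof.
move=> s t s1 t1.
apply: (@xgetPex _ 0 [set l | abs_cvg v (psum q binom s t) l]%classic) => /=.
apply: (abs_complete_series absv completev (rho := v t)).
  by rewrite (abs_ge0 absv).
move=> n; rewrite /psum big_ord_recr /= [_ - _]addrC addKr.
have tn : v t ^+ (q ^ n) <= v t ^+ n.
  have nq : (n <= q ^ n)%N by rewrite ltnW // ltn_expl.
  by rewrite -(subnK nq) exprD ler_piMl ?exprn_ge0 ?exprn_ile1 ?(abs_ge0 absv) ?ltW.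
apply: abs_sum_le => // [|m _]; first by rewrite exprn_ge0 ?(abs_ge0 absv).
rewrite -mulrA (absM absv (Kbinom _ _ _ _)) abs_Kbinom -1?ltnS // mul1r.
rewrite (absM absv) !(absX absv).
apply: le_trans tn; rewrite ler_piMl ?exprn_ge0 ?(abs_ge0 absv) //.
by rewrite exprn_ile1 ?(abs_ge0 absv) ?ltW.
Qed.

Lemma eq_psum (a b : nat -> nat -> C) s t n :
  (forall m k, (m <= k)%N -> a m k = b m k) -> psum q a s t n = psum q b s t n.
Proof.
by move=> ab; apply: eq_bigr => k _; apply: eq_bigr => m _; rewrite ab // -ltnS.
Qed.

Lemma psum_Delta a s t n :
  psum q (fun m k => a m k * br k) s t n = psum q a s (x * t) n - x * psum q a s t n.
Proof.
rewrite /psum mulr_sumr -sumrB; apply: eq_bigr => k _.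
rewrite mulr_sumr -sumrB; apply: eq_bigr => m _.
by rewrite exprMn /bracket; ring.
Qed.

Lemma psum_dilate_s a s t n :
  psum q (fun m k => a m k * br m) s t n = psum q a (x * s) t n - x * psum q a s t n.
Proof.
rewrite /psum mulr_sumr -sumrB; apply: eq_bigr => k _.
rewrite mulr_sumr -sumrB; apply: eq_bigr => m _.
by rewrite exprMn /bracket; ring.
Qed.

Lemma psum_sum (I : Type) (r : seq I) (P : pred I) (c : I -> C)
    (a : I -> nat -> nat -> C) s t n :
  psum q (fun m k => \sum_(i <- r | P i) c i * a i m k) s t n =
  \sum_(i <- r | P i) c i * psum q (a i) s t n.
Proof.
rewrite [RHS](eq_bigr (fun i => \sum_(k < n) \sum_(m < k.+1)
    c i * a i m k * s ^+ (q ^ m) * t ^+ (q ^ k))); last first.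
  by move=> i _; rewrite mulr_sumr; apply: eq_bigr => k _;
     rewrite mulr_sumr; apply: eq_bigr => m _; rewrite !mulrA.
rewrite exchange_big; apply: eq_bigr => k _.
rewrite exchange_big; apply: eq_bigr => m _.
by rewrite !mulr_suml.
Qed.

(** Raising to the power $q$ moves the coefficient at $(m, k)$, to the power $q$, to
    $(m + 1, k + 1)$. *)
Definition tau_coef (a : nat -> nat -> C) (m k : nat) : C :=
  if m is m'.+1 then a m' k.-1 ^+ q else 0.

Lemma psum_tau a s t n : psum q (tau_coef a) s t n.+1 = psum q a s t n ^+ q.
Proof.
rewrite /psum big_ord_recl big_ord1 /= !mul0r add0r (frob_sum frobD q_gt0).
apply: eq_bigr => k _; rewrite big_ord_recl /= !mul0r add0r (frob_sum frobD q_gt0).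
by apply: eq_bigr => m _; rewrite !exprMn -!exprM -!expnSr.
Qed.

Lemma iter_tau_coef_lt l a m k : (m < l)%N -> iter l tau_coef a m k = 0.
Proof.
elim: l m k => // l IH [|m] k //; rewrite ltnS => ml /=.
by rewrite IH // expr0n gtn_eqF.
Qed.

Lemma iter_tau_coef_add l a m k :
  iter l tau_coef a (m + l)%N (k + l)%N = a m k ^+ (q ^ l).
Proof.
elim: l => [|l IH]; first by rewrite !addn0 expn0 expr1.
by rewrite iterS !addnS /= IH -exprM -expnSr.
Qed.

Lemma eq_disk_expands a b g :
  (forall m k, (m <= k)%N -> a m k = b m k) -> disk_expands a g -> disk_expands b g.
Proof.
move=> ab ag s t s1 t1; have := ag s t s1 t1.
by congr abs_cvg; apply/funext => n; apply: eq_psum.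
Qed.

Lemma disk_expands_sum (I : Type) (r : seq I) (P : pred I) (c : I -> C) a g :
  (forall i, P i -> disk_expands (a i) (g i)) ->
  disk_expands (fun m k => \sum_(i <- r | P i) c i * a i m k)
    (fun s t => \sum_(i <- r | P i) c i * g i s t).
Proof.
move=> ag s t s1 t1.
rewrite (_ : psum _ _ _ _ = fun n => \sum_(i <- r | P i) c i * psum q (a i) s t n).
  by apply: abs_cvg_sum => // i Pi; apply: abs_cvgZ => //; apply: ag.
by apply/funext => n; apply: psum_sum.
Qed.

Lemma disk_expands_Delta a g :
  disk_expands a g -> disk_expands (fun m k => a m k * br k) (Delta g).
Proof.
move=> ag s t s1 t1; rewrite /Delta_t -mulNr.
rewrite (_ : psum _ _ _ _ = fun n => psum q a s (x * t) n + - x * psum q a s t n).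
  apply: abs_cvgD => //; first by apply: ag => //; apply: disk_mulx.
  by apply: abs_cvgZ => //; apply: ag.
by apply/funext => n; rewrite psum_Delta mulNr.
Qed.

Lemma disk_expands_tau a g : disk_expands a g -> disk_expands (tau_coef a) (tau q g).
Proof.
move=> ag s t s1 t1; apply: abs_cvg_unshift => //.
rewrite (_ : (fun _ => _) = fun n => psum q a s t n ^+ q).
  by apply: abs_cvg_frob => //; apply: ag.
by apply/funext => n; apply: psum_tau.
Qed.

(** Termwise, $g(xs, t) - x g(s, t)$ has coefficients $a_{m,k} [m]$, which vanish
    for $m = 0$; the hypothesis says that they are those of $h^q$.  So $h$ is a
    $q$-th root, hence the one that [qroot] picks. *)
Lemma disk_eq_d_s a g b h : disk_expands a g -> disk_expands b h ->
    (forall m k, (m <= k)%N -> b m k ^+ q = a m.+1 k.+1 * br m.+1) ->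
  disk_eq (d_s q x g) h.
Proof.
move=> ag bh ba s t s1 t1; rewrite /d_s.
suff -> : g (x * s) t - x * g s t = h s t ^+ q by apply: qroot_expr.
apply: (abs_cvg_unique absv (u := psum q (tau_coef b) s t)); last first.
  exact: disk_expands_tau.
rewrite (_ : psum _ _ _ _ = fun n => psum q a (x * s) t n + - x * psum q a s t n).
  rewrite -mulNr; apply: abs_cvgD => //; first by apply: ag => //; apply: disk_mulx.
  by apply: abs_cvgZ => //; apply: ag.
apply/funext => n; rewrite mulNr -psum_dilate_s; apply: eq_psum => -[|m] [|k] //= mk.
- by rewrite /bracket expn0 expr1 subrr mulr0.
- by rewrite /bracket expn0 expr1 subrr mulr0.
- exact: ba.
Qed.

Lemma disk_expands_iter_Delta i :
  disk_expands (fun m k => Kbinom q x k m * br k ^+ i) (iter i Delta f).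
Proof.
elim: i => [|i IH].
  by apply: eq_disk_expands disk_expands_series => m k _; rewrite expr0 mulr1.
by apply: eq_disk_expands (disk_expands_Delta IH) => m k _; rewrite exprSr mulrA.
Qed.

(** The operator $p(\Delta_t)$ applied to $f$; the bound $n$ on the number of
    coefficients is kept separate from the size of $p$ so that it can be fixed in
    advance. *)
Definition Delta_poly (n : nat) (p : {poly C}) (s t : C) : C :=
  \sum_(i < n) p`_i * iter i Delta f s t.

(** $\Delta_t$ multiplies the coefficient at $t^{q^k}$ by $[k]$, so $p(\Delta_t)$
    multiplies it by $p([k])$. *)
Lemma disk_expands_Delta_poly n (p : {poly C}) : (size p <= n)%N ->
  disk_expands (fun m k => Kbinom q x k m * p.[br k]) (Delta_poly n p).
Proof.
move=> pn; apply: eq_disk_expands (@disk_expands_sum _ (index_enum 'I_n) xpredT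
  (fun i => p`_i) _ _ (fun i _ => disk_expands_iter_Delta i)) => m k _.
rewrite (horner_coef_wide _ pn) mulr_sumr.
by apply: eq_bigr => i _; rewrite mulrCA.
Qed.

(** The differential equation in polynomial form:
    $d_s p(\Delta_t) f = p^{1/q}(\Delta_t + \lambda) (\Delta_t + \lambda) f$ with
    $\lambda^q = [1]$.  On coefficients, the $q$-th power of
    $p^{1/q}([k] + \lambda) ([k] + \lambda)$ is $p([k+1]) [k+1]$, and the factor
    $[k+1]$ is absorbed by the recursion for the binomials. *)
Lemma d_s_Delta_poly n (p p1 : {poly C}) (lam : C) :
    lam ^+ q = br 1 -> (forall y, p1.[y] ^+ q = p.[y ^+ q]) ->
    (size p <= n)%N -> (size p1 <= n)%N ->
  disk_eq (d_s q x (Delta_poly n p))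
    (Delta_poly n.+1 ((p1 \Po ('X + lam%:P)) * ('X + lam%:P))).
Proof.
move=> lamq p1q pn p1n; apply: disk_eq_d_s.
- exact: disk_expands_Delta_poly.
- apply: disk_expands_Delta_poly.
  rewrite (leq_trans (size_polyMleq _ _)) // size_XaddC addn2 /= ltnS.
  by rewrite size_comp_poly2 ?size_XaddC.
move=> m k mk; rewrite [RHS]mulrAC KbinomSS hornerM horner_comp hornerD hornerX hornerC.
by rewrite !exprMn p1q frobD lamq bracketS mulrA mulrAC.
Qed.

Lemma disk_eq_trans g h k : disk_eq g h -> disk_eq h k -> disk_eq g k.
Proof. by move=> gh hk s t s1 t1; rewrite gh // hk. Qed.

Lemma disk_eq_congr_d_s g h : disk_eq g h -> disk_eq (d_s q x g) (d_s q x h).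
Proof.
by move=> gh s t s1 t1; rewrite /d_s !gh //; apply: disk_mulx.
Qed.

Lemma iter_tauE l (g : C -> C -> C) s t : iter l (tau q) g s t = g s t ^+ (q ^ l).
Proof.
elim: l => [|l IH]; first by rewrite expn0 expr1.
by rewrite iterS /tau IH -exprM -expnSr.
Qed.

(** * Independence of the monomials in tau and Delta *)

Definition tau_Delta (l i : nat) : C -> C -> C := iter l (tau q) (iter i Delta f).

(** The exponents $(l, i)$ of the monomials $\tau^l \Delta_t^i$ of total degree at
    most $j$. *)
Definition triangle j : {set 'I_j.+1 * 'I_j.+1} :=
  [set p : 'I_j.+1 * 'I_j.+1 | (p.1 + p.2 <= j)%N].

Lemma disk_expands_tau_Delta l i : disk_expands
  (iter l tau_coef (fun m k => Kbinom q x k m * br k ^+ i)) (tau_Delta l i).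
Proof.
elim: l => [|l IH]; first exact: disk_expands_iter_Delta.
exact: disk_expands_tau.
Qed.

(** The coefficient of $\tau^l \Delta_t^i f$ at $(m, k)$ vanishes for $m < l$, and
    at $(l, K + l)$ it equals $[K]^{i q^l}$.  Once the $c_{l',i}$ with $l' < l$ are
    known to vanish, the coefficients of the relation at $(l, K + l)$ say that the
    polynomial $\sum_i c_{l,i} X^i$ has the infinitely many roots $[K]^{q^l}$. *)
Lemma tau_Delta_free j (c : 'I_j.+1 * 'I_j.+1 -> C) :
    germ_eq v (fun s t => \sum_(p in triangle j) c p * tau_Delta p.1 p.2 s t)
      (fun _ _ => 0) ->
  forall p, p \in triangle j -> c p = 0.
Proof.
case=> r r0 c0.
pose a (p : 'I_j.+1 * 'I_j.+1) :=
  iter p.1 tau_coef (fun m k => Kbinom q x k m * br k ^+ p.2).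
have aS := @disk_expands_sum _ (index_enum ('I_j.+1 * 'I_j.+1)%type)
  (fun p => p \in triangle j) c a _ (fun p _ => disk_expands_tau_Delta p.1 p.2).
have a_sum0 m k : (m <= k)%N -> \sum_(p in triangle j) c p * a p m k = 0.
  move: m k; apply: (psum_coef_eq0 (a := fun m k => \sum_(p in triangle j) c p * a p m k)
    absv q_gt1 x01 (r := Num.min r 1)).
    by rewrite lt_min r0 ltr01.
  move=> s t; rewrite !lt_min => /andP[sr s1] /andP[tr t1].
  by have := aS s t s1 t1; rewrite c0.
move=> p0; have [l pl] : exists l : nat, p0.1 = l :> nat by eexists.
elim/ltn_ind: l p0 pl => l IH p0 pl p0j.
pose P := \sum_(p in triangle j | p.1 == l :> nat) c p *: 'X^(p.2).
have P0 : P = 0.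
  apply: (@poly_infinite_roots _ _ (fun K => br K ^+ (q ^ l))).
    by move=> K K' /(frobX_inj frobD q_gt0)/bracket_inj.
  move=> K; rewrite horner_sum.
  have := a_sum0 _ _ (leq_addl K l); rewrite -{1}[l]add0n.
  rewrite (bigID (fun p : 'I_j.+1 * 'I_j.+1 => p.1 == l :> nat)) /=.
  rewrite [X in _ + X]big1 ?addr0 => [S0|p /andP[pj]].
    rewrite -[RHS]S0; apply: eq_bigr => p /andP[_ /eqP pl'].
    rewrite /a pl' iter_tau_coef_add Kbinom0 mul1r hornerZ hornerXn.
    by rewrite -!exprM mulnC.
  rewrite neq_ltn add0n => /orP[pl'|pl']; first by rewrite (IH _ pl') ?mul0r.
  by rewrite /a iter_tau_coef_lt ?mulr0.
(* Only the pair p0 contributes, its first component being fixed to l. *)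
have : P`_(p0.2) = 0 by rewrite P0 coef0.
rewrite coef_sum (bigD1 p0) ?p0j ?pl ?eqxx //= coefZ coefXn eqxx mulr1 big1 ?addr0 //.
case=> l' i' /= /andP[/andP[_ /eqP l'l] ne].
rewrite coefZ coefXn; case: eqP => [ii|_]; last by rewrite mulr0.
case/negP: ne; apply/eqP; case: p0 pl ii {p0j} => l0 i0 /= pl ii.
by congr (_, _); apply/val_inj; rewrite /= ?l'l ?pl ?ii.
Qed.

(** * The filtration is spanned by the monomials in tau and Delta *)

Definition triangle_span j (g : C -> C -> C) : Prop :=
  exists c : 'I_j.+1 * 'I_j.+1 -> C,
    disk_eq g (fun s t => \sum_(p in triangle j) c p * tau_Delta p.1 p.2 s t).

Lemma triangle_span_gen j l i : (l + i <= j)%N -> triangle_span j (tau_Delta l i).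
Proof.
move=> lij.
have lj : (l < j.+1)%N by rewrite ltnS (leq_trans (leq_addr i l)).
have ij : (i < j.+1)%N by rewrite ltnS (leq_trans (leq_addl l i)).
pose p0 := (Ordinal lj, Ordinal ij).
exists (fun p => (p == p0)%:R) => s t _ _.
rewrite (bigD1 p0) ?inE //= eqxx mul1r big1 ?addr0 // => p /andP[_ /negbTE->].
by rewrite mul0r.
Qed.

Lemma triangle_span_scale j c g :
  triangle_span j g -> triangle_span j (fun s t => c * g s t).
Proof.
case=> d gd; exists (fun p => c * d p) => s t s1 t1; rewrite gd // mulr_sumr.
by apply: eq_bigr => p _; rewrite mulrA.
Qed.

Lemma triangle_span_sum j (I : Type) (r : seq I) (P : pred I) (g : I -> C -> C -> C) :
  (forall i, P i -> triangle_span j (g i)) ->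
  triangle_span j (fun s t => \sum_(i <- r | P i) g i s t).
Proof.
move=> gj; elim: r => [|i r [d IH]].
  by exists (fun=> 0) => s t _ _; rewrite big_nil big1 // => p _; rewrite mul0r.
have [Pi|nPi] := boolP (P i); last first.
  by exists d => s t s1 t1; rewrite big_cons (negbTE nPi) IH.
have [d' gd'] := gj i Pi; exists (fun p => d' p + d p) => s t s1 t1.
rewrite big_cons Pi gd' // IH // -big_split; apply: eq_bigr => p _.
by rewrite mulrDl.
Qed.

Lemma triangle_span_eq j g h : disk_eq g h -> triangle_span j h -> triangle_span j g.
Proof. by move=> gh [d hd]; exists d; apply: disk_eq_trans hd. Qed.

(** Row $l$ holds $j + 1 - l$ exponents; counted from the last row, this is the sum
    $1 + 2 + \dots + (j + 1)$. *)
Lemma card_triangle j : #|triangle j| = 'C(j.+2, 2).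
Proof.
rewrite -sum1_card.
transitivity (\sum_(l < j.+1) \sum_(i < j.+1 | (l + i <= j)%N) 1)%N.
  by rewrite pair_big_dep /=; apply: eq_bigl => p; rewrite inE.
rewrite -bin2_sum big_mkord [RHS]big_ord_recl /= add0n [LHS](reindex_inj rev_ord_inj) /=.
apply: eq_bigr => l _; rewrite -[RHS](card_ord l.+1) -sum1_card.
rewrite (big_ord_widen_cond j.+1 xpredT (fun=> 1%N)) //.
apply: eq_bigl => i; have := ltn_ord l; rewrite ltnS /= /bump; lia.
Qed.

Lemma mem_filtration_tau_Delta j l i : (l + i <= j)%N ->
  filtration v q x f j (tau_Delta l i).
Proof.
move=> lij.
have lj : (l < j.+1)%N by rewrite ltnS (leq_trans (leq_addr i l)).
have ij : (i < j.+1)%N by rewrite ltnS (leq_trans (leq_addl l i)).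
exists (fun l' mu i' => ((l' == l) && (mu == 0%N) && (i' == i))%:R).
apply: disk_eq_germ => s t _ _.
rewrite (bigD1 (Ordinal lj)) //= [X in _ + X]big1 ?addr0 => [|l' /negbTE nl]; last first.
  rewrite big1 // => mu _; rewrite big1 // => i' _.
  by rewrite (_ : (l' == l :> nat) = false) ?mul0r // -nl.
rewrite (bigD1 ord0) //= [X in _ + X]big1 ?addr0 => [|mu /negbTE nmu]; last first.
  rewrite big1 // => i' _.
  by rewrite (_ : (mu == 0%N :> nat) = false) ?andbF ?mul0r // -nmu.
rewrite (bigD1 (Ordinal ij)) /= ?addn0 // !eqxx mul1r big1 ?addr0 //.
move=> i' /andP[_ /negbTE ni].
by rewrite (_ : (i' == i :> nat) = false) ?mul0r // -ni.
Qed.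

(** Iterating $d_s$ takes $q$-th roots of coefficients.  They exist in an
    algebraically closed field $L$ inside $C$, so it is enough to know that all the
    polynomials in $\Delta_t$ that arise have coefficients in $L$. *)
Section AlgebraicCoefficients.
Variables (L : closedFieldType) (iC : {rmorphism L -> C}) (xL : L).
Hypothesis iCx : iC xL = x.

Lemma closed_qroot (y : L) : exists z, z ^+ q = y.
Proof.
have : size ('X^q - y%:P) != 1 by rewrite size_XnsubC // eqSS -lt0n.
case/closed_rootP => z; rewrite rootE !hornerE => /eqP/subr0_eq zy.
by exists z.
Qed.

Lemma exists_bracket1_root : exists lam : L, iC lam ^+ q = br 1.
Proof.
(* The element $x^q - x$ is $[1]$, read in L. *)
have [lam lamq] := closed_qroot (xL ^+ q - xL).
by exists lam; rewrite -rmorphXn lamq rmorphB rmorphXn iCx /bracket expn1.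
Qed.

Lemma poly_frob_root (p : {poly L}) : exists2 p1 : {poly L}, (size p1 <= size p)%N &
  forall y : C, (map_poly iC p1).[y] ^+ q = (map_poly iC p).[y ^+ q].
Proof.
have [rt rtq] := choice closed_qroot.
exists (\poly_(i < size p) rt p`_i) => [|y]; first exact: size_poly.
rewrite (@horner_coef_wide _ (size p)) ?size_map_poly ?size_poly //.
rewrite (@horner_coef_wide _ (size p)) ?size_map_poly //.
rewrite (frob_sum frobD q_gt0); apply: eq_bigr => i _.
by rewrite !coef_map coef_poly ltn_ord exprMn -rmorphXn rtq -!exprM mulnC.
Qed.

(** Each $d_s$ is traded for one more factor $\Delta_t + \lambda$, so the degree in
    $\Delta_t$ grows by at most the order in $d_s$ and the filtration is respected. *)
Lemma iter_d_s_Delta mu i : exists2 p : {poly L}, (size p <= (mu + i).+1)%N &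
  disk_eq (iter mu (d_s q x) (iter i Delta f))
          (Delta_poly (mu + i).+1 (map_poly iC p)).
Proof.
elim: mu => [|mu [p pn gp]].
  exists 'X^i => [|s t _ _]; first by rewrite size_polyXn.
  rewrite /Delta_poly map_polyXn big_ord_recr /= coefXn eqxx mul1r big1 ?add0r // => k _.
  by rewrite coefXn ltn_eqF ?mul0r.
have [p1 p1p p1q] := poly_frob_root p.
have [lam lamC] := exists_bracket1_root.
have p1n := leq_trans p1p pn.
exists ((p1 \Po ('X + lam%:P)) * ('X + lam%:P)).
  rewrite (leq_trans (size_polyMleq _ _)) // size_XaddC addn2 /= addSn ltnS.
  by rewrite size_comp_poly2 ?size_XaddC.
rewrite rmorphM /= map_comp_poly rmorphD /= map_polyX map_polyC /=.
apply: disk_eq_trans (disk_eq_congr_d_s gp) _.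
by apply: d_s_Delta_poly; rewrite ?size_map_poly.
Qed.

Lemma triangle_span_monomial j l mu i : (l + mu + i <= j)%N ->
  triangle_span j (iter l (tau q) (iter mu (d_s q x) (iter i Delta f))).
Proof.
move=> lmij; have [p _ gp] := iter_d_s_Delta mu i.
apply: triangle_span_eq (_ : disk_eq _ (fun s t => \sum_(k < (mu + i).+1)
  (map_poly iC p)`_k ^+ (q ^ l) * tau_Delta l k s t)) _ => [s t s1 t1|].
  rewrite iter_tauE gp // (frob_sum (frobXD frobD l)) ?expn_gt0 ?q_gt0 //.
  by apply: eq_bigr => k _; rewrite exprMn /tau_Delta iter_tauE.
apply: triangle_span_sum => k _; apply/triangle_span_scale/triangle_span_gen.
by apply: leq_trans lmij; rewrite -addnA leq_add2l -ltnS.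
Qed.

Lemma filtration_triangle_span j g : filtration v q x f j g ->
  exists c : 'I_j.+1 * 'I_j.+1 -> C,
    germ_eq v g (fun s t => \sum_(p in triangle j) c p * tau_Delta p.1 p.2 s t).
Proof.
case=> d [r r0 gd].
have [c hc] : triangle_span j (fun s t =>
    \sum_(l < j.+1) \sum_(mu < j.+1) \sum_(i < j.+1 | (l + mu + i <= j)%N)
      d l mu i * iter l (tau q) (iter mu (d_s q x) (iter i Delta f)) s t).
  apply: triangle_span_sum => l _; apply: triangle_span_sum => mu _.
  apply: triangle_span_sum => i lmij.
  exact/triangle_span_scale/triangle_span_monomial.
exists c; exists (Num.min r 1) => [|s t]; first by rewrite lt_min r0 ltr01.
by rewrite !lt_min => /andP[sr s1] /andP[tr t1]; rewrite gd // hc.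
Qed.

Lemma germ_dim_filtration j : germ_dim v (filtration v q x f j) 'C(j.+2, 2).
Proof.
rewrite -card_triangle.
have p0j : (ord0, ord0) \in triangle j by rewrite inE.
exists (fun k : 'I_#|triangle j| => tau_Delta (enum_val k).1 (enum_val k).2); split.
- move=> k; apply: mem_filtration_tau_Delta.
  by have := enum_valP k; rewrite inE.
- move=> c c0 k.
  rewrite -(enum_valK_in p0j k).
  apply: (@tau_Delta_free _ (fun p => c (enum_rank_in p0j p))) (enum_valP k).
  case: c0 => r r0 c0; exists r => // s t sr tr; rewrite -[RHS](c0 s t sr tr).
  by rewrite big_enum_val; apply: eq_bigr => i _; rewrite enum_valK_in.
- move=> g /filtration_triangle_span[c [r r0 gc]].
  exists (fun k : 'I_#|triangle j| => c (enum_val k)), r => // s t sr tr.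
  by rewrite gc // big_enum_val.
Qed.

(** The dimensions are the triangular numbers $(j + 1)(j + 2)/2$. *)
Lemma module_dim_series : module_dim v q x f 2.
Proof.
exists (2^-1 *: (('X + 1%:P) * ('X + 2%:P))); split.
  have sX (c : rat) : size ('X + c%:P) = 2 by exact: size_XaddC.
  by rewrite size_scale // size_Mmonic ?monicXaddC ?sX // -size_poly_eq0 sX.
exists 0%N => j _; exists 'C(j.+2, 2); split; first exact: germ_dim_filtration.
rewrite hornerZ hornerM !hornerD hornerX !hornerC.
apply: (@mulfI _ 2) => //; rewrite mulVKf //.
rewrite -natrM -(mul_bin_diag j.+2 1) bin1 natrM /=.
by rewrite -[j.+2]addn2 -[j.+1]addn1 !natrD mulrC.
Qed.

(** The case $p = 1$ of the formula for $d_s p(\Delta_t) f$. *)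
Lemma d_s_series :
  germ_eq v (d_s q x f) (fun s t => Delta f s t + qroot q (br 1) * f s t).
Proof.
have [lam lamq] := exists_bracket1_root.
rewrite -lamq (qroot_expr frobD q_gt0); apply: disk_eq_germ.
have f1 : disk_eq f (Delta_poly 1 1).
  by move=> s t _ _; rewrite /Delta_poly big_ord1 coef1 mul1r.
apply: disk_eq_trans (disk_eq_congr_d_s f1) _.
apply: disk_eq_trans (@d_s_Delta_poly 1 1 1 _ lamq _ _ _) _; rewrite ?size_poly1 //.
  by move=> y; rewrite !hornerE expr1n.
move=> s t _ _; rewrite /Delta_poly comp_polyC mul1r.
by rewrite big_ord_recl big_ord1 /= !coefD !coefX !coefC /= add0r addr0 mul1r addrC.
Qed.

End AlgebraicCoefficients.

(** The independence result at $j = 0$, where the only monomial is $f$ itself. *)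
Lemma series_germ_neq0 : ~ germ_eq v f (fun _ _ => 0).
Proof.
case=> r r0 f0.
have one0 := @tau_Delta_free 0 (fun=> 1) _ (ord0, ord0).
apply/negP: (oner_neq0 C); rewrite negbK; apply/eqP/one0; last by rewrite inE.
exists r => // s t sr tr; rewrite (big_pred1 (ord0, ord0)) ?mul1r; first exact: f0.
by move=> [l i]; rewrite !ord1 inE.
Qed.

End CarlitzOperators.

(** * The Laurent series field and the main result *)

Lemma finField_card_pnat (F : finFieldType) : exists2 p, p \in [pchar F] & p.-nat #|F|.
Proof.
have [p p_pr pF] := finPcharP F; exists p => //.
by have /abelem_pgroup := fin_ring_pchar_abelem pF; rewrite /pgroup cardsT.
Qed.

Lemma pchar_laurent (F : fieldType) p : p \in [pchar F] -> p \in [pchar (laurent F)].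
Proof.
rewrite !inE => /andP[-> /eqP p0]; apply/eqP/laurentP => n.
have mulrn_coef m : (1 *+ m : laurent F) n = (n == 0)%:R *+ m.
  by elim: m => // m IH; rewrite !mulrS lcoefD IH.
by rewrite mulrn_coef lcoef0 -[LHS]mulr_natr p0 mulr0.
Qed.

Lemma laurent_abs_lmono1 (R : realType) (F : finFieldType) :
  laurent_abs R (lmono F 1) = #|F|%:R^-1.
Proof.
rewrite /laurent_abs (negbTE (lmono_neq0 _ _)) (_ : laurent_ord _ = 1) ?exprN1 //.
rewrite /laurent_ord; set S := (X in xget _ X).
have [N0 Nlow] : S (xget 0 S).
  apply: xgetPex; exists 1; split; last exact: lmono_low.
  by rewrite /= /lmono_fun eqxx oner_neq0.
move: N0; rewrite /= /lmono_fun; have [-> //|ne1] := eqVneq (xget 0 S) 1.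
by rewrite eqxx.
Qed.

Theorem proposition7 (R : realType) (F : finFieldType)
    (L : closedFieldType) (C : fieldType)
    (iL : {rmorphism laurent F -> L}) (vL : L -> R)
    (iC : {rmorphism L -> C}) (vC : C -> R)
    (closureL : is_algebraic_closure iL)
    (absL : is_abs vL)
    (extL : forall y : laurent F, vL (iL y) = laurent_abs R y)
    (absC : is_abs vC)
    (complC : is_completion vL vC iC) :
  let q := #|F| in
  let x : C := iC (iL (lmono F 1)) in
  let binom := fun m k : nat => Kbinom q x k m in
  let f := series_sum vC q binom in
  [/\ expands_as vC q binom f,
      germ_eq vC (d_s q x f)
        (fun s t => Delta_t x f s t + qroot q (bracket q x 1) * f s t)
    & quasi_holonomic vC q x f].
Proof.
move=> q x binom f; have [vCL completeC _] := complC.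
have q_gt1 : (1 < q)%N := finNzRing_gt1 F.
have frobC a b : (a + b) ^+ q = a ^+ q + b ^+ q :> C.
  have [p pF pq] := finField_card_pnat F.
  apply: exprDn_pchar.
  have pC : p \in [pchar C] by apply/(rmorph_pchar iC)/(rmorph_pchar iL)/pchar_laurent.
  by rewrite (eq_pnat _ (pcharf_eq pC)).
have x01 : 0 < vC x < 1.
  rewrite vCL extL laurent_abs_lmono1 invr_gt0 ltr0n ltnW //=.
  by rewrite invf_lt1 ?ltr0n ?ltr1n // ltnW.
have fE := disk_expands_series absC q_gt1 x01 completeC.
have f_expands : expands_as vC q binom f by exists 1.
split=> //; first exact: d_s_series.
split; [by exists binom | exact: series_germ_neq0 | exact: module_dim_series].
Qed.
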